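(* Assume the generalized continuum hypothesis. Let $\alpha$ be an infinite cardinal, $(Y,\le_Y)$ a nonempty partially ordered set and $(P,\le_P)$ an $\alpha$-universal poset. The following are equivalent. (i) $(Y,\le_Y)$ is a local $\alpha$-quasilattice. (ii) For every poset $(X,\le_X)$ and every $A\subseteq X$ having a greatest and a least element and satisfying $|A|<\alpha$, every isotone map $f\colon A\to Y$ has an isotone extension to $X$ preserving extremal values. (iii) For every poset $(X,\le_X)$ with $|X|<\alpha$ and every $A\subseteq X$ having a greatest and a least element, every isotone map $f\colon A\to Y$ has an isotone extension to $X$ preserving extremal values. (iv) For every $A\subseteq P$ having a greatest and a least element and such that $|A|<\alpha$, every isotone map $f\colon A\to Y$ extends to an isotone map $P\to Y$.
   Context: A map is isotone if $x\le y$ implies $f(x)\le f(y)$; subsets carry the induced order; an isotone extension of $f\colon A\to Y$ is an isotone map agreeing with $f$ on $A$. If $A$ has least element $a_*$ and greatest element $a^*$, an isotone extension $g\colon X\to Y$ of $f$ preserves extremal values if $f(a_* )\le_Y g(x)\le_Y f(a^* )$ for all $x\in X$. A subset $A$ of a poset is bounded if it has at least one lower bound and at least one upper bound. For an infinite cardinal $\alpha$, $(Y,\le_Y)$ is a local $\alpha$-quasilattice if for any two bounded $A,B\subseteq Y$ with $\max(|A|,|B|)<\alpha$ and $a\le_Y b$ for all $a\in A,b\in B$, there is $y^*\in Y$ with $a\le_Y y^*\le_Y b$ for all $a\in A,b\in B$. A poset $P$ is $\alpha$-universal if every poset $X$ with $|X|<\alpha$ is order-isomorphic to a subset of $P$ with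 the induced order. *)

(* Defs.v *)
From HB Require Import structures.
From mathcomp Require Import all_boot all_order.
From mathcomp Require Import boolp classical_sets functions cardinality.

Set Implicit Arguments.
Unset Strict Implicit.
Unset Printing Implicit Defensive.

Import Order.TTheory.

Local Open Scope classical_set_scope.
Local Open Scope card_scope.
Local Open Scope order_scope.

(* The induced order on a subset: a set [A : set T] used as a type is
   [set_type A], which unfolds to [{x : T | x \in A}]. *)
HB.instance Definition _ (d : Order.disp_t) (T : porderType d) (P : pred T) :=
  [SubChoice_isSubPOrder of {x : T | P x} by <: with d].

Definition card_lt (T U : Type) (A : set T) (B : set U) : Prop :=
  A #<= B /\ ~ (B #<= A).

Notation "A '#<' B" := (card_lt A B) (at level 70, no associativity) : card_scope.

(* Cardinals are represented by types of that cardinality; [set T] realizes the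
   power 2 ^ |T|. *)
Definition GCH : Prop :=
  forall T U : Type, infinite_set [set: T] ->
    ~ ([set: T] #< [set: U] /\ [set: U] #< [set: set T]).

Definition isotone (dX dY : Order.disp_t) (X : porderType dX)
    (Y : porderType dY) (f : X -> Y) : Prop :=
  {homo f : x y / x <= y}.

Definition is_least (d : Order.disp_t) (X : porderType d) (A : set X) (a : X) :
    Prop :=
  A a /\ lbound A a.

Definition is_greatest (d : Order.disp_t) (X : porderType d) (A : set X)
    (a : X) : Prop :=
  A a /\ ubound A a.

Definition has_least_greatest (d : Order.disp_t) (X : porderType d)
    (A : set X) : Prop :=
  (exists a, is_least A a) /\ (exists a, is_greatest A a).

Definition bounded (d : Order.disp_t) (X : porderType d) (A : set X) : Prop :=
  has_lbound A /\ has_ubound A.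

Definition isotone_extension (dX dY : Order.disp_t) (X : porderType dX)
    (Y : porderType dY) (A : set X) (f : A -> Y) (g : X -> Y) : Prop :=
  isotone g /\ forall a : A, g (val a) = f a.

Definition preserves_extremal_values (dX dY : Order.disp_t) (X : porderType dX)
    (Y : porderType dY) (A : set X) (f : A -> Y) (g : X -> Y) : Prop :=
  forall a b : A, is_least A (val a) -> is_greatest A (val b) ->
    forall x : X, f a <= g x <= f b.

(* The two bounds on [y] are separate so that the conclusion is not vacuous when
   exactly one of [A] and [B] is empty. *)
Definition local_quasilattice (alpha : Type) (d : Order.disp_t)
    (Y : porderType d) : Prop :=
  forall A B : set Y,
    bounded A -> bounded B ->
    A #< [set: alpha] -> B #< [set: alpha] ->
    (forall a b, A a -> B b -> a <= b) ->
    exists y : Y, (forall a, A a -> a <= y) /\ (forall b, B b -> y <= b).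

Definition universal_poset (alpha : Type) (d : Order.disp_t)
    (P : porderType d) : Prop :=
  forall (dX : Order.disp_t) (X : porderType dX), [set: X] #< [set: alpha] ->
    exists (S : set P) (e : X -> S),
      bijective e /\ {mono e : x y / x <= y}.

(* Main.v *)
(* For (i) => (ii), send each point x of X to its cut in A: the points of A below
   x and the points of A above x. It is enough to extend f monotonically to cuts.
   There are at most 2 ^ |A| of them, hence at most alpha by GCH, so they can be
   well-ordered with all proper initial segments of size < alpha, and (i) then
   supplies the values one cut at a time.
   Conversely, given A <= B in Y, both (iii) and (iv) extend the identity of Y
   (restricted to A, B and two bounds) to a poset with one extra point between A
   and B, and the value at that point separates A from B. *)
Require Import Defs.
From mathcomp Require Import all_boot all_order.
From mathcomp Require Import boolp classical_sets functions cardinality wochoice.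

Set Implicit Arguments.
Unset Strict Implicit.
Unset Printing Implicit Defensive.

Import Order.TTheory.

Local Open Scope classical_set_scope.
Local Open Scope card_scope.
Local Open Scope order_scope.

(** * Comparison and addition of cardinals *)

Lemma card_leTP (T U : Type) :
  [set: T] #<= [set: U] <-> exists f : T -> U, injective f.
Proof.
split=> [/card_leP[f]|[f f_inj]].
  exists (fun x => val (f (exist _ x (mem_set I)))) => x y /val_inj fxy.
  have : exist (fun z => z \in [set: T]) x (mem_set I) = exist _ y (mem_set I).
    by apply: (@inj _ _ _ f) => //; exact: mem_set.
  by case.
apply/card_leP/injfunPex => /=.
exists (fun x : set_type setT =>
  exist (fun z => z \in [set: U]) (f (val x)) (mem_set I)).
  by [].
by move=> x y _ _ [] /f_inj /val_inj.
Qed.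

Lemma card_le_leT (T U : Type) (A : set T) (B : set U) :
  (A #<= B) = ([set: A] #<= [set: B]).
Proof. by rewrite (card_le_eql (card_setT A)) (card_le_eqr (card_setT B)). Qed.

Lemma card_le_lt_trans (T U V : Type) (A : set T) (B : set U) (C : set V) :
  A #<= B -> B #< C -> A #< C.
Proof.
move=> AB [BC CB]; split; first exact: card_le_trans AB BC.
by move=> CA; apply: CB; exact: card_le_trans CA AB.
Qed.

(** Zorn's lemma on graphs of partial injections: a maximal graph is total on one side, since
    otherwise a pair of two missed points could be added. *)
Lemma card_leT_total (T U : Type) :
  [set: T] #<= [set: U] \/ [set: U] #<= [set: T].
Proof.
pose P := [set G : set (T * U) |
  forall p q, G p -> G q -> (p.1 = q.1 -> p = q) /\ (p.2 = q.2 -> p = q)].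
have [|G [PG Gmax]] := @Zorn_bigcup _ P.
  move=> F FP Ftot p q [X FX Xp] [Y FY Yq].
  have [XY|YX] := Ftot _ _ FX FY; first by apply: (FP _ FY) => //; exact: XY.
  by apply: (FP _ FX) => //; exact: YX.
have [Gl|/existsNP[t Gt]] := pselect (forall t, exists u, G (t, u)).
  left; apply/card_leTP; have [f Gf] := choice Gl; exists f => x y fxy.
  by have [_ /(_ fxy)[]] := PG _ _ (Gf x) (Gf y).
have [Gr|/existsNP[u Gu]] := pselect (forall u, exists t, G (t, u)).
  right; apply/card_leTP; have [f Gf] := choice Gr; exists f => x y fxy.
  by have [/(_ fxy)[]] := PG _ _ (Gf x) (Gf y).
exfalso; apply: (Gmax ((t, u) |` G)).
  split; first exact: subsetUr.
  by move=> /(_ (t, u) (or_introl erefl)) Gtu; apply: Gt; exists u.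
move=> [p1 p2] [q1 q2] [[-> ->]|Gp] [[-> ->]|Gq] //=; last exact: (PG (p1, p2) (q1, q2)).
  by split=> E; [case: Gt; exists q2; rewrite E|case: Gu; exists q1; rewrite E].
by split=> E; [case: Gt; exists p2; rewrite -E|case: Gu; exists p1; rewrite -E].
Qed.

Lemma card_nltT (T U : Type) :
  ~ [set: T] #< [set: U] -> [set: U] #<= [set: T].
Proof.
move=> nTU; have [TU|//] := card_leT_total T U.
by apply: contrapT => UT; apply: nTU.
Qed.

(* A maximal disjoint family of countable sequences leaves only a finite
   remainder, so T embeds into (family) * nat; then nat + nat ~ nat. *)
Lemma card_sum_self (T : Type) :
  infinite_set [set: T] -> [set: T + T] #<= [set: T].
Proof.
move=> /infiniteP /card_leTP[e0 e0_inj].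
have [E [Einj Etriv Emax]] :=
  @ex_maximal_disjoint_subcollection _ _ (fun e : nat -> T => range e)
    [set e | injective e].
pose R := (~` \bigcup_(e in E) range e)%classic.
(* An injective sequence inside the remainder [R] could be added to [E], against maximality. *)
have Rmax (f : nat -> T) : injective f -> ~ (range f `<=` R).
  move=> f_inj fR; apply: (Emax (f |` E)).
  - split; first exact: subsetUr.
    move=> /(_ f (or_introl erefl)) Ef.
    by apply: (fR (f 0%N)); [exists 0%N|exists f => //; exists 0%N].
  - by move=> e [->|/Einj].
  - move=> f1 f2 [->|E1] [->|E2] // [x [x1 x2]].
    + by have [] := fR _ x1; exists f2.
    + by have [] := fR _ x2; exists f1.
    + by apply: Etriv => //; exists x.
have R_fin : finite_set R.
  apply/finite_setPn; rewrite card_le_leT.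
  rewrite (card_le_eql (card_setT [set: nat])) => /card_leTP[f f_inj].
  apply: (Rmax (fun n => val (f n))) => [n m /val_inj /f_inj //|_ [n _ <-]].
  exact/set_mem/valP.
have [h h_inj] : exists h : T -> nat, {in R &, injective h}.
  exact/pcard_injP/finite_set_countable.
have [e1 Ee1] : E !=set0.
  apply/set0P/eqP => E0; apply: (Rmax _ e0_inj) => x _ [e].
  by rewrite E0.
(* [k] codes the points of [T] injectively by a sequence of [E] and an index: points in some range
   get even indices, and the finite remainder gets odd indices on the fixed sequence [e1]. *)
have /choice[k kP] : forall x, exists en : (nat -> T) * nat, E en.1 /\
    ((exists2 n, en.2 = n.*2 & en.1 n = x) \/ (R x /\ en.2 = (h x).*2.+1)).
  move=> x; have [[e Ee [n _ <-]]|Rx] := pselect ((\bigcup_(e in E) range e) x).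
    by exists (e, n.*2); split=> //; left; exists n.
  by exists (e1, (h x).*2.+1); split=> //; right.
have k_inj : injective k.
  move=> x y kxy; have [_ +] := kP x; have [_ +] := kP y; rewrite kxy.
  case=> [[n yn ny]|[Ry yn]] [[m xm mx]|[Rx xm]]; move: xm; rewrite yn.
  - by move=> /double_inj nm; rewrite -mx -[RHS]ny nm.
  - by move=> /(congr1 odd); rewrite /= !odd_double.
  - by move=> /(congr1 odd); rewrite /= !odd_double.
  - by move=> [/double_inj]/esym; apply: h_inj; apply/mem_set.
apply/card_leTP.
(* The two copies of [T] go to the even and the odd terms of the sequences in [E], whose ranges are
   disjoint. *)
exists (fun s => match s with
  | inl x => (k x).1 (k x).2.*2 | inr x => (k x).1 (k x).2.*2.+1 end).
have uniqE x y n m : (k x).1 n = (k y).1 m -> (k x).1 = (k y).1 /\ n = m.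
  move=> E1; have [Ex _] := kP x; have [Ey _] := kP y.
  have kxy : (k x).1 = (k y).1.
    by apply: Etriv => //; exists ((k x).1 n); split; [exists n|exists m].
  by split=> //; apply: (Einj _ Ex); rewrite E1 kxy.
case=> x [] y /uniqE[k1].
- move/double_inj => k2; congr inl; apply: k_inj.
  by rewrite [LHS]surjective_pairing k1 k2 -surjective_pairing.
- by move=> /(congr1 odd); rewrite /= !odd_double.
- by move=> /(congr1 odd); rewrite /= !odd_double.
- move=> [/double_inj k2]; congr inr; apply: k_inj.
  by rewrite [LHS]surjective_pairing k1 k2 -surjective_pairing.
Qed.

Lemma finite_sum (T U : Type) :
  finite_set [set: T] -> finite_set [set: U] -> finite_set [set: T + U].
Proof.
move=> Tfin Ufin; apply: (@sub_finite_set _ _ (inl @` setT `|` inr @` setT)%classic).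
  by case=> x _; [left|right]; exists x.
by rewrite finite_setU; split; exact: finite_image.
Qed.

Lemma finite_powerT (T : Type) :
  finite_set [set: T] -> finite_set [set: set T].
Proof.
move=> [n]; rewrite (card_eqr card_II) card_eq_le => /andP[/card_leTP[f f_inj] _].
pose F (S : set T) := [ffun i => `[< exists2 x, S x & f x = i >]].
apply: (@card_le_finite _ _ _ [set: {ffun 'I_n -> bool}]); last first.
  exact: finite_finset.
apply/card_leTP; exists F => S S' /ffunP SS'; apply/predeqP => x.
have := SS' (f x); rewrite !ffunE => SS'x; have E := asbool_eq_equiv SS'x.
split=> Sx.
  by have [y S'y /f_inj <-] := E.1 (ex_intro2 _ _ x Sx erefl).
by have [y Sy /f_inj <-] := E.2 (ex_intro2 _ _ x Sx erefl).
Qed.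

(** The sum embeds into two copies of the larger summand; these form a finite type or embed back
    into that summand. *)
Lemma card_lt_sum (alpha T U : Type) : infinite_set [set: alpha] ->
  [set: T] #< [set: alpha] -> [set: U] #< [set: alpha] ->
  [set: T + U] #< [set: alpha].
Proof.
move=> alpha_inf Ta Ua; wlog TU : T U Ta Ua / [set: T] #<= [set: U].
  move=> th; have [/th|UT] := card_leT_total T U; first exact.
  apply: card_le_lt_trans (th _ _ Ua Ta UT); apply/card_leTP.
  exists (fun s => match s with inl x => inr x | inr y => inl y end).
  by move=> [x|x] [y|y] // [->].
suff UU : [set: U + U] #< [set: alpha].
  apply: card_le_lt_trans UU; have /card_leTP[f f_inj] := TU.
  apply/card_leTP.
  exists (fun s => match s with inl x => inl (f x) | inr y => inr y end).
  by move=> [x|x] [y|y] // [] => [/f_inj|] ->.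
have [Ufin|/card_sum_self Uinf] := pselect (finite_set [set: U]); last first.
  exact: card_le_lt_trans Uinf Ua.
have naU : ~ ([set: alpha] #<= [set: U + U]).
  by move=> /card_le_finite -/(_ (finite_sum Ufin Ufin)).
by split=> //; have [|/naU] := card_leT_total (U + U) alpha.
Qed.

(** * Power sets under GCH and short well-orderings *)

(** For infinite [T], a failure would put [alpha] strictly between [T] and [set T]; for finite [T],
    the power set is finite. *)
Lemma GCH_card_power (alpha T : Type) : GCH -> infinite_set [set: alpha] ->
  [set: T] #< [set: alpha] -> [set: set T] #<= [set: alpha].
Proof.
move=> gch alpha_inf Ta.
have [/finite_powerT/finite_set_countable Tfin|Tinf] := pselect (finite_set [set: T]).
  by apply: card_le_trans Tfin _; exact/infiniteP.
by apply: card_nltT => aT; apply: (gch T alpha Tinf).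
Qed.

Lemma well_ordering (T : Type) : exists lt : T -> T -> Prop,
  well_founded lt /\ forall x y, lt x y \/ x = y \/ lt y x.
Proof.
have [R Rwo] := @well_ordering_principle {classic T}.
have Rchain : wo_chain R predT by move=> A _; exact: Rwo.
have Rtot x y : R x y || R y x := @wo_chainW {classic T} R predT Rchain x y isT isT.
have Ranti x y : R x y && R y x -> x = y :=
  @wo_chain_antisymmetric {classic T} R predT Rchain x y isT isT.
exists (fun x y => R x y /\ x <> y); split.
  move=> x; apply: contrapT => nx.
  have [|z [[nz zmin] _]] :=
    Rwo (fun x => `[< ~ Acc (fun x y => R x y /\ x <> y) x >]).
    by exists x; exact/asboolP.
  move/asboolP: nz; apply; split=> y [Ryz yz]; apply: contrapT => ny.
  by apply: yz; apply: Ranti; rewrite Ryz; apply: zmin; exact/asboolP.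
move=> x y; have [->|xy] := pselect (x = y); first by right; left.
by have /orP[] := Rtot x y; [left|right; right; split=> // /esym].
Qed.

(** A recursion along [lt] meets fewer than [alpha] earlier points at each stage, which is the size
    that a local quasilattice can interpolate. *)
Lemma well_ordering_short (alpha T : Type) : [set: T] #<= [set: alpha] ->
  exists lt : T -> T -> Prop,
  [/\ well_founded lt, forall x y, lt x y \/ x = y \/ lt y x
    & forall x, [set y | lt y x] #< [set: alpha]].
Proof.
move=> Talpha; have [lt [lt_wf lt_tri]] := well_ordering alpha.
pose big a := [set: alpha] #<= [set b | lt b a].
(* Replacing [alpha] by its least initial segment of full cardinality makes all
   proper initial segments small. *)
have [i i_inj i_small] : exists2 i : T -> alpha, injective i & forall x, ~ big (i x).
  have [[a biga]|nbig] := pselect (exists a, big a); last first.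
    have /card_leTP[i i_inj] := Talpha; exists i => // x bigx.
    by apply: nbig; exists (i x).
  elim/(well_founded_ind lt_wf) : a biga => a IH biga.
  have [[b [ba /IH]]|nb] := pselect (exists b, lt b a /\ big b); first exact.
  have := card_le_trans Talpha biga; rewrite card_le_leT.
  rewrite (card_le_eql (card_setT [set: T])) => /card_leTP[i i_inj].
  exists (fun x => val (i x)) => [x y /val_inj/i_inj //|x bigx].
  by apply: nb; exists (val (i x)); split=> //; exact: (set_mem (valP (i x))).
exists (fun x y => lt (i x) (i y)); split=> [x|x y|x].
- move: {2}(i x) (erefl (i x)) => a; elim/(well_founded_ind lt_wf) : a x.
  by move=> a IH x ixa; split=> y yx; apply: (IH (i y)) => //; rewrite -ixa.
- by have [|[/i_inj|]] := lt_tri (i x) (i y); [left|right; left|right; right].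
- split; first exact: card_le_trans (card_leT _) Talpha.
  move=> le; apply: (i_small x); apply: (card_le_trans le).
  rewrite -(card_le_eql (inj_card_eq (in2W i_inj))).
  by apply: subset_card_le => _ [y yx <-].
Qed.

(** * Extension of isotone maps through cuts *)

(** Here [lo i c] and [hi i c] say that [i] belongs to the lower or upper part of the cut [c].
    Values are chosen by transfinite recursion on [C]: each is interpolated between the data of its
    cut and the values already given to comparable cuts. *)
Lemma cut_interpolation (alpha : Type) (dY : Order.disp_t) (Y : porderType dY)
    (I C : Type) (lo hi : I -> C -> Prop) (le : C -> C -> Prop)
    (f : I -> Y) (i0 i1 : I) :
  infinite_set [set: alpha] -> local_quasilattice alpha Y ->
  [set: I] #< [set: alpha] -> [set: C] #<= [set: alpha] ->
  (forall c, lo i0 c /\ hi i1 c) -> (forall i, f i0 <= f i <= f i1) ->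
  (forall c i j, lo i c -> hi j c -> f i <= f j) ->
  (forall c c' i, le c c' -> lo i c -> lo i c') ->
  (forall c c' i, le c c' -> hi i c' -> hi i c) ->
  (forall a b c, le a b -> le b c -> le a c) ->
  exists g : C -> Y,
  [/\ forall c c', le c c' -> g c <= g c',
      forall i c, lo i c -> f i <= g c & forall i c, hi i c -> g c <= f i].
Proof.
move=> alpha_inf Yql Ia Ca lohi01 f01 lohi lo_le hi_le letr.
have [lt [lt_wf lt_tri lt_small]] := well_ordering_short Ca.
pose between c (g : forall b, lt b c -> Y) := [set y |
  [/\ forall i, lo i c -> f i <= y, forall i, hi i c -> y <= f i,
      forall b (bc : lt b c), le b c -> g b bc <= y
    & forall b (bc : lt b c), le c b -> y <= g b bc]].
(* The default [f i0] only makes the recursion total: [gP] shows that an admissible value always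
   exists. *)
pose g := Fix lt_wf (fun _ => Y) (fun c g => xget (f i0) (between c g)).
have gE c : g c = xget (f i0) (between c (fun b _ => g b)).
  rewrite {1}/g Fix_eq // => x g1 g2 g12; congr xget; congr between.
  by apply/functional_extensionality_dep => b; apply/functional_extensionality_dep.
suff gP c : between c (fun b _ => g b) (g c).
  exists g; split=> [b c bc|i c|i c].
  - have [|[->//|]] := lt_tri b c => lt_bc.
      by have [_ _ + _] := gP c; apply.
    by have [_ _ _ +] := gP b; apply.
  - by have [+ _ _ _] := gP c; apply.
  - by have [_ + _ _] := gP c; apply.
elim/(well_founded_ind lt_wf) : c => c IH; rewrite gE; apply: xgetPex.
(* [h] lists the data and the earlier values; [L] and [U] select those that must lie below,
   respectively above, the value at [c]. *)
pose h (s : I + [set b | lt b c]) :=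
  match s with inl i => f i | inr b => g (val b) end.
pose L := [set s : I + [set b | lt b c] |
  match s with inl i => lo i c | inr b => le (val b) c end].
pose U := [set s : I + [set b | lt b c] |
  match s with inl i => hi i c | inr b => le c (val b) end].
have ltP (b : [set b | lt b c]) : lt (val b) c by exact: (set_mem (valP b)).
have small (S : set (I + [set b | lt b c])) : h @` S #< [set: alpha].
  apply: (@card_le_lt_trans _ _ _ _ [set: I + [set b | lt b c]]).
    exact: card_le_trans (card_image_le _ _) (card_leT _).
  apply: card_lt_sum => //; apply: card_le_lt_trans (lt_small c).
  by rewrite (card_le_eql (card_setT _)).
have hbound s : f i0 <= h s <= f i1.
  case: s => [//|b] /=; have [lo_g hi_g _ _] := IH _ (ltP b).
  by have [lo0 hi1] := lohi01 (val b); rewrite lo_g ?hi_g.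
have hbounded (S : set (I + [set b | lt b c])) : bounded (h @` S).
  by split; [exists (f i0)|exists (f i1)] => _ [s _ <-]; have /andP[] := hbound s.
have [|y [Ly Uy]] := Yql _ _ (hbounded L) (hbounded U) (small L) (small U).
- move=> _ _ [s Ls <-] [t Ut <-].
  case: s t Ls Ut => [i|a] [j|b] /=.
  + exact: lohi.
  + move=> lo_i cb; have [lo_g _ _ _] := IH _ (ltP b).
    by apply: lo_g; exact: lo_le lo_i.
  + move=> ac hi_j; have [_ hi_g _ _] := IH _ (ltP a).
    by apply: hi_g; exact: hi_le hi_j.
  (* Of two distinct earlier cuts, the later one received a value that respects the value of the
     other. *)
  + move=> ac cb; have ab := letr _ _ _ ac cb.
    have [|[->//|]] := lt_tri (val a) (val b) => lt_ab.
      by have [_ _ + _] := IH _ (ltP b); apply.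
    by have [_ _ _ +] := IH _ (ltP a); apply.
exists y; split=> [i lo_i|i hi_i|b bc le_bc|b bc le_cb].
- by apply: Ly; exists (inl i).
- by apply: Uy; exists (inl i).
- by apply: Ly; exists (inr (exist _ b (mem_set bc))).
- by apply: Uy; exists (inr (exist _ b (mem_set bc))).
Qed.

Lemma quasilattice_extension (alpha : Type) (dX dY : Order.disp_t)
    (X : porderType dX) (Y : porderType dY) (A : set X) (f : A -> Y) :
  GCH -> infinite_set [set: alpha] -> local_quasilattice alpha Y ->
  has_least_greatest A -> A #< [set: alpha] -> isotone f ->
  exists g : X -> Y, isotone_extension f g /\ preserves_extremal_values f g.
Proof.
move=> gch alpha_inf Yql [[l0 [Al lA]] [u0 [Au uA]]] Aa f_iso.
have {}Aa : [set: A] #< [set: alpha].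
  by apply: card_le_lt_trans Aa; rewrite (card_le_eql (card_setT _)).
pose l : A := exist _ l0 (mem_set Al); pose u : A := exist _ u0 (mem_set Au).
have lf a : f l <= f a by apply: f_iso; exact: lA (set_mem (valP a)).
have fu a : f a <= f u by apply: f_iso; exact: uA (set_mem (valP a)).
(* The left summand holds the lower part and the right one the upper part. Compatibility is required
   of the values of [f], and [l] and [u] are in every cut so that all values lie between [f l] and
   [f u]. *)
pose cut := {c : set (A + A) |
  [/\ c (inl l), c (inr u)
    & forall a b, c (inl a) -> c (inr b) -> f a <= f b]}.
have cut_small : [set: cut] #<= [set: alpha].
  apply: card_le_trans (GCH_card_power gch alpha_inf (card_lt_sum alpha_inf Aa Aa)).
  by apply/card_leTP; exists sval => x y; exact: eq_sig_hprop.
have [] := @cut_interpolation alpha _ Y A cut (fun a c => sval c (inl a))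
    (fun a c => sval c (inr a))
    (fun c d => (forall a, sval c (inl a) -> sval d (inl a)) /\
                (forall a, sval d (inr a) -> sval c (inr a)))
    f l u alpha_inf Yql Aa cut_small.
- by move=> [c []].
- by move=> a; rewrite lf fu.
- by move=> [c []].
- by move=> c d a [+ _]; apply.
- by move=> c d a [_ +]; apply.
- by move=> a b c [ab ba] [bc cb]; split=> x; [move=> /ab/bc|move=> /cb/ba].
move=> g [g_iso g_lo g_hi].
(* A point [x] need not lie between [l] and [u], so these two are adjoined by hand. *)
pose around (x : X) : set (A + A) := fun s =>
  match s with inl a => val a <= x \/ a = l | inr a => x <= val a \/ a = u end.
have aroundP x : [/\ around x (inl l), around x (inr u)
    & forall a b, around x (inl a) -> around x (inr b) -> f a <= f b].
  split; [by right|by right|].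
  by move=> a b [ax|->] // [xb|->] //; apply: f_iso; exact: le_trans ax xb.
pose cut_of x : cut := exist _ (around x) (aroundP x).
exists (fun x => g (cut_of x)); split.
  split=> [x y xy|a].
    apply: g_iso; split=> a [ax|->]; [left|right|left|right] => //.
      exact: le_trans ax xy.
    exact: le_trans xy ax.
  (* A point of [A] lies in both parts of its own cut, which forces the value there. *)
  by apply: le_anti; rewrite g_lo ?g_hi //; left.
move=> a b [_ aA] [_ bA] x.
have ca : f a <= f l by apply: f_iso; exact: aA.
have ub : f u <= f b by apply: f_iso; exact: bA.
by rewrite (le_trans ca) ?(le_trans _ ub) ?g_lo ?g_hi //; right.
Qed.

(** * From extension properties back to local quasilattices *)

Lemma card_lt_finite (alpha T : Type) (A : set T) :
  infinite_set [set: alpha] -> finite_set A -> A #< [set: alpha].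
Proof.
move=> alpha_inf Afin; split; last by move=> /card_le_finite/(_ Afin).
by apply: card_le_trans (finite_set_countable Afin) _; exact/infiniteP.
Qed.

Lemma card_lt_setU (alpha T : Type) (A B : set T) : infinite_set [set: alpha] ->
  A #< [set: alpha] -> B #< [set: alpha] -> (A `|` B)%classic #< [set: alpha].
Proof.
move=> alpha_inf Aa Ba.
have ltT (S : set T) : S #< [set: alpha] -> [set: S] #< [set: alpha].
  by apply: card_le_lt_trans; rewrite (card_le_eql (card_setT _)).
apply: card_le_lt_trans (card_lt_sum alpha_inf (ltT _ Aa) (ltT _ Ba)).
pose h (s : A + B) := match s with inl x => val x | inr x => val x end.
apply: card_le_trans (card_image_le h _); apply: subset_card_le => x [Ax|Bx].
  by exists (inl (exist _ x (mem_set Ax))).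
by exists (inr (exist _ x (mem_set Bx))).
Qed.

Lemma card_lt_image (alpha T U : Type) (h : T -> U) (A : set T) :
  A #< [set: alpha] -> h @` A #< [set: alpha].
Proof. by apply: card_le_lt_trans; exact: card_image_le. Qed.

(** The common consequence of (iii) and (iv) from which (i) is recovered. *)
Definition extends_small_posets (alpha : Type) (dY : Order.disp_t)
    (Y : porderType dY) : Prop :=
  forall (dX : Order.disp_t) (X : porderType dX), [set: X] #< [set: alpha] ->
  forall A : set X, has_least_greatest A ->
  forall f : A -> Y, isotone f -> exists g : X -> Y, isotone_extension f g.

(* The points of A and B are encoded as principal down-sets, so that the down-set
   generated by A is a point sitting between them. *)
Lemma extends_small_posets_quasilattice (alpha : Type) (dY : Order.disp_t)
    (Y : porderType dY) :
  infinite_set [set: alpha] -> extends_small_posets alpha Y ->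
  local_quasilattice alpha Y.
Proof.
move=> alpha_inf ext A B [[l lA] [uA uAP]] [[lB lBP] [u uB]] Aa Ba AB.
(* When [A] or [B] is empty, a bound of the other set already separates them. *)
have [->|/set0P[a0 Aa0]] := eqVneq A set0; first by exists lB; split.
have [->|/set0P[b0 Bb0]] := eqVneq B set0; first by exists uA; split.
have lB' b : B b -> l <= b by move=> Bb; apply: le_trans (lA _ Aa0) (AB _ _ Aa0 Bb).
have uA' a : A a -> a <= u by move=> Aa1; apply: le_trans (AB _ _ Aa1 Bb0) (uB _ Bb0).
(* Adjoining [l] and [u] provides the least and greatest elements that the extension property asks
   for. *)
pose D := (A `|` B `|` ([set l] `|` [set u]))%classic.
have lD d : D d -> l <= d.
  move=> [[/lA|/lB']|[->|->]] //; exact: le_trans (lA _ Aa0) (uA' _ Aa0).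
have uD d : D d -> d <= u.
  move=> [[/uA'|/uB]|[->|->]] //; exact: le_trans (lA _ Aa0) (uA' _ Aa0).
have Dl : D l by right; left.
have Du : D u by right; right.
pose down y : set Y := [set z | z <= y].
have downP y z : (down y <= down z) = (y <= z).
  apply/idP/idP; first by rewrite subsetEset => /(_ y (lexx y)).
  by rewrite subsetEset => yz x xy; exact: le_trans yz.
pose p : set Y := [set z | exists2 a, A a & z <= a].
(* [p] may coincide with some [down d], for instance when [A] has a greatest element; the argument
   covers this case too. *)
pose X : set (set Y) := ((down @` D) `|` [set p])%classic.
have Xa : [set: X] #< [set: alpha].
  apply: (@card_le_lt_trans _ _ _ _ X); first by rewrite (card_le_eql (card_setT _)).
  apply: card_lt_setU => //; last exact/card_lt_finite/finite_set1.
  apply: card_lt_image; apply: card_lt_setU => //; first exact: card_lt_setU.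
  by apply: card_lt_finite => //; rewrite finite_setU; split; exact: finite_set1.
pose A' : set X := [set S | (down @` D) (val S)].
pose pt d (Dd : D d) : X := exist _ (down d) (mem_set (or_introl (imageP down Dd))).
have A'pt d (Dd : D d) : A' (pt d Dd) by exists d.
have A'lg : has_least_greatest A'.
  split; [exists (pt l Dl)|exists (pt u Du)]; split=> // S [d Dd dS].
    by rewrite -Order.le_val /= -dS downP lD.
  by rewrite -Order.le_val /= -dS downP uD.
have /choice[f fP] : forall S : A', exists d, down d = val (val S).
  by move=> S; have [d _ dS] := set_mem (valP S); exists d.
have f_iso : isotone f.
  by move=> S T; rewrite -!Order.le_val -!fP downP.
have [g [g_iso gf]] := ext _ _ Xa _ A'lg _ f_iso.
have g_pt d (Dd : D d) : g (pt d Dd) = d.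
  have := gf (exist _ (pt d Dd) (mem_set (A'pt d Dd))) => /= ->.
  by apply: le_anti; rewrite -!downP fP /= lexx.
pose pX : X := exist _ p (mem_set (or_intror erefl)).
(* The inclusions of [down a] in [p] and of [p] in [down b] become the two required inequalities
   under [g]. *)
exists (g pX); split=> [a Aa1|b Bb].
  have Da : D a by left; left.
  rewrite -(g_pt a Da); apply: g_iso; rewrite -Order.le_val /= subsetEset => z za.
  by exists a.
have Db : D b by left; right.
rewrite -(g_pt b Db); apply: g_iso; rewrite -Order.le_val /= subsetEset => z [a Aa1 za].
exact: le_trans za (AB _ _ Aa1 Bb).
Qed.

(** A small poset is embedded into [P], the map is transported to the image of [A] and extended to
    all of [P], and the extension is pulled back along the embedding. *)
Lemma universal_extends_small_posets (alpha : Type) (dY dP : Order.disp_t)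
    (Y : porderType dY) (P : porderType dP) :
  universal_poset alpha P ->
  (forall A : set P, has_least_greatest A -> A #< [set: alpha] ->
   forall f : A -> Y, isotone f -> exists g : P -> Y, isotone_extension f g) ->
  extends_small_posets alpha Y.
Proof.
move=> Puniv ext dX X Xa A [[l [Al lA]] [u [Au uA]]] f f_iso.
have [S [e0 [_ e0_mono]]] := Puniv _ _ Xa.
pose e x := val (e0 x).
have e_mono x y : (e x <= e y) = (x <= y) by rewrite -e0_mono -Order.le_val.
have eAlg : has_least_greatest (e @` A).
  split; [exists (e l)|exists (e u)]; (split; first exact: imageP).
    by move=> _ [x Ax <-]; rewrite e_mono lA.
  by move=> _ [x Ax <-]; rewrite e_mono uA.
have eAa : e @` A #< [set: alpha].
  apply: card_lt_image; exact: card_le_lt_trans (card_leT A) Xa.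
have /choice[r rP] : forall s : e @` A, exists a : A, e (val a) = val s.
  by move=> s; have [a Aa es] := set_mem (valP s); exists (exist _ a (mem_set Aa)).
have fr_iso : isotone (f \o r).
  by move=> s t st; apply: f_iso; rewrite -Order.le_val -e_mono !rP Order.le_val.
have [g [g_iso gf]] := ext _ eAlg eAa _ fr_iso.
exists (g \o e); split=> [x y xy|a /=]; first by apply: g_iso; rewrite e_mono.
have eaA : (e @` A) (e (val a)) by apply: imageP; exact: (set_mem (valP a)).
pose s : e @` A := exist _ (e (val a)) (mem_set eaA).
have := gf s => /= ->; congr f; apply/val_inj.
by apply: le_anti; rewrite -!e_mono rP /= lexx.
Qed.

Theorem theorem5p8 (gch : GCH)
    (alpha : Type) (alpha_infinite : infinite_set [set: alpha])
    (dY : Order.disp_t) (Y : porderType dY) (Y_nonempty : [set: Y] !=set0)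
    (dP : Order.disp_t) (P : porderType dP)
    (P_universal : universal_poset alpha P) :
  [<-> (* (i) *)
       local_quasilattice alpha Y;
       (* (ii) *)
       forall (dX : Order.disp_t) (X : porderType dX) (A : set X),
         has_least_greatest A -> A #< [set: alpha] ->
         forall f : A -> Y, isotone f ->
         exists g : X -> Y,
           isotone_extension f g /\ preserves_extremal_values f g;
       (* (iii) *)
       forall (dX : Order.disp_t) (X : porderType dX),
         [set: X] #< [set: alpha] ->
         forall A : set X, has_least_greatest A ->
         forall f : A -> Y, isotone f ->
         exists g : X -> Y,
           isotone_extension f g /\ preserves_extremal_values f g;
       (* (iv) *)
       forall A : set P,
         has_least_greatest A -> A #< [set: alpha] ->
         forall f : A -> Y, isotone f ->
         exists g : P -> Y, isotone_extension f g].
Proof.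
have ext_ql := @extends_small_posets_quasilattice alpha dY Y alpha_infinite.
tfae=> [Yql dX X A Alg Aa f f_iso|ext dX X Xa A Alg f f_iso|ext A Alg Aa f f_iso|ext].
- exact: (quasilattice_extension gch alpha_infinite Yql).
- apply: ext => //; exact: card_le_lt_trans (card_leT A) Xa.
(* [P] itself may have size at least [alpha], so (iii) is not applied to it directly: the route to
   (iv) goes through (i). *)
- have Yql : local_quasilattice alpha Y.
    apply: ext_ql => dX X Xa B Blg h /(ext _ _ Xa _ Blg)[g [g_ext _]].
    by exists g.
  have [g [g_ext _]] :=
    quasilattice_extension gch alpha_infinite Yql Alg Aa f_iso.
  by exists g.
- exact/ext_ql/(universal_extends_small_posets P_universal).
Qed.
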